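(* Assume the Slater condition holds for (LSIP), and that for some Slater point $\bar{x}$ the level set $L(\bar{x}) = \{x\in F \mid c^{\top}x\leq c^{\top}\bar{x}\}$ is bounded. Let $\{T_k\}_{k\ge 0}$ be a sequence of subdivisions of $Y$ such that $T_0$ is consistent (i.e. $F(T_0)\neq\emptyset$), $T_k\subseteq T_{k+1}$ for all $k$, and $\lim_{k\to \infty} |T_k| = 0$. For each $k$ let $x_k^*$ be an optimal solution of R1-LSIP($T_k$). Then any accumulation point of the sequence $\{x_k^*\}$ is an optimal solution of (LSIP).
   Context: Problem (LSIP): let $Y=[a,b]\subset\mathbb{R}$ with $a<b$, $c\in\mathbb{R}^n$, and coefficient functions $a_i:\mathbb{R}\to\mathbb{R}$, $i=0,1,\dots,n$; put $a(y)=[a_1(y),\dots,a_n(y)]^{\top}$ and $\mathbb{R}^n_+=\{x\in\mathbb{R}^n\mid x_i\ge 0,\ i=1,\dots,n\}$. (LSIP) is: minimize $c^{\top}x$ over the feasible set $F=\{x\in\mathbb{R}^n_+\mid a(y)^{\top}x+a_0(y)\ge 0\ \ \forall y\in Y\}$. Slater condition: there exists $\bar{x}\in\mathbb{R}^n_+$ with $a(y)^{\top}\bar{x}+a_0(y)>0$ for all $y\in Y$; such an $\bar{x}$ is called a Slater point. Subdivision: $T=\{\tau_0,\dots,\tau_N\}$ with $a=\tau_0\le\tau_1\le\dots\le\tau_N=b$; $Y_k=[\tau_{k-1},\tau_k]$, $|Y_k|=|\tau_k-\tau_{k-1}|$, $|T|=\max_{1\le k\le N}|Y_k|$. Inclusion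 functions: for each $i=0,\dots,n$ and each subinterval $Z\subseteq Y$, an interval $A_i(Z)=[A_i^l(Z),A_i^u(Z)]$ is given that contains the range of $a_i$ on $Z$, denoted $[R_i^l(Z),R_i^u(Z)]$. Standing assumption on tightness: there are constants $p\ge 1$, $\gamma_i\ge 0$, $\delta_i\ge 0$ (independent of $Z$) such that for all subintervals $Z\subseteq Y$ of length $|Z|$, $\max\{|R_i^l(Z)-A_i^l(Z)|,|R_i^u(Z)-A_i^u(Z)|\}\le\gamma_i|Z|^p$ and $|A_i^l(Z)-A_i^u(Z)|\le\delta_i|Z|^p$. Approximate problem: for a subdivision $T$ put $A_{i,k}^l=A_i^l(Y_k)$. R1-LSIP($T$) is: minimize $c^{\top}x$ over $F(T)=\{x\in\mathbb{R}^n_+\mid \sum_{i=1}^n A_{i,k}^l x_i+A_{0,k}^l\ge 0,\ k=1,\dots,N\}$. $T$ is called consistent if $F(T)\neq\emptyset$. *)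

(* Defs.v *)
From HB Require Import structures.
From mathcomp Require Import all_boot all_order all_algebra.
From mathcomp Require Import all_classical all_reals all_analysis.

Set Implicit Arguments.
Unset Strict Implicit.
Unset Printing Implicit Defensive.

Import Order.TTheory GRing.Theory Num.Theory.
Import numFieldNormedType.Exports.

Local Open Scope classical_set_scope.
Local Open Scope ring_scope.

Section LSIP.
Context {R : realType} {n : nat}.
Implicit Types (a b : R) (c x : 'cV[R]_n) (coef : 'I_n.+1 -> R -> R).
Implicit Types (Al Au : 'I_n.+1 -> set R -> R) (T : seq R) (Z : set R).

Definition dot c x : R := \sum_(i < n) c i ord0 * x i ord0.

Definition orthant : set 'cV[R]_n := [set x | forall i, 0 <= x i ord0].

(* Index ord0 of a coefficient family carries the constant term, and
   lift ord0 i the coefficient of the i-th unknown. *)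
Definition affine (u : 'I_n.+1 -> R) x : R :=
  \sum_(i < n) u (lift ord0 i) * x i ord0 + u ord0.

Definition optimal_solution c (S : set 'cV[R]_n) x : Prop :=
  S x /\ forall z, S z -> dot c x <= dot c z.

Definition feasible a b coef : set 'cV[R]_n :=
  [set x | orthant x /\
    forall y, y \in `[a, b] -> 0 <= affine (coef ^~ y) x].

Definition slater_point a b coef x : Prop :=
  orthant x /\ forall y, y \in `[a, b] -> 0 < affine (coef ^~ y) x.

Definition slater_condition a b coef : Prop :=
  exists x, slater_point a b coef x.

Definition level_set a b coef c xbar : set 'cV[R]_n :=
  [set x | feasible a b coef x /\ dot c x <= dot c xbar].

(* Breakpoints may be repeated, so that degenerate cells are allowed. *)
Definition subdivision a b T : Prop :=
  [/\ (1 < size T)%N, T`_0 = a, T`_(size T).-1 = b & sorted <=%R T].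

(* Cells are numbered from 0: cell T k is the k.+1-st subinterval. *)
Definition cell T (k : nat) : set R := `[T`_k, T`_k.+1]%classic.

Definition mesh T : R :=
  \big[Num.max/0]_(0 <= k < (size T).-1) `|T`_k.+1 - T`_k|.

(* [Al i Z, Au i Z] is the interval assigned to the i-th coefficient on Z;
   only the values at nonempty closed subintervals of [a, b] matter. *)
Definition inclusion_functions a b coef Al Au : Prop :=
  forall i s t, a <= s -> s <= t -> t <= b ->
    let Z := `[s, t]%classic in coef i @` Z `<=` `[Al i Z, Au i Z]%classic.

Definition range_lower coef i Z : R := inf (coef i @` Z).
Definition range_upper coef i Z : R := sup (coef i @` Z).

Definition tight_inclusion a b coef Al Au : Prop :=
  exists (p : R) (gamma delta : 'I_n.+1 -> R),
    [/\ 1 <= p, (forall i, 0 <= gamma i), (forall i, 0 <= delta i) &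
      forall i s t, a <= s -> s <= t -> t <= b ->
        let Z := `[s, t]%classic in
        Num.max `|range_lower coef i Z - Al i Z|
                `|range_upper coef i Z - Au i Z| <= gamma i * (t - s) `^ p
        /\ `|Al i Z - Au i Z| <= delta i * (t - s) `^ p].

Definition approx_feasible Al T : set 'cV[R]_n :=
  [set x | orthant x /\
    forall k, (k < (size T).-1)%N -> 0 <= affine (Al ^~ (cell T k)) x].

Definition consistent Al T : Prop := approx_feasible Al T !=set0.

End LSIP.

(* Main.v *)
Require Import Defs.
From mathcomp Require Import all_boot all_order all_algebra.
From mathcomp Require Import all_classical all_reals all_analysis.
From mathcomp Require Import lra.
Import Order.TTheory GRing.Theory Num.Theory.
Import numFieldNormedType.Exports.
Local Open Scope classical_set_scope.
Local Open Scope ring_scope.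

Set Implicit Arguments.
Unset Strict Implicit.

(** Shrinking the coefficients only shrinks a feasible set, so F(T) is contained
    in F and every accumulation point is feasible because F is closed.
    Tightness makes the coefficients Lipschitz at small scale on [a, b], so a
    Slater point satisfies the constraints with a uniform margin and hence lies
    in F(T) once T is fine enough.  For z in F the points (1 - t) z + t xbar,
    0 < t <= 1, are Slater points, so an accumulation point x satisfies
    c x <= (1 - t) c z + t c xbar, and t tends to 0. *)

(** * Closed half-spaces *)

Lemma closed_ge_preimage {R : realType} {X : topologicalType} (f : X -> R) r :
  continuous f -> closed [set x | r <= f x].
Proof.
move=> cf; have -> : [set x | r <= f x] = f @^-1` [set y | r <= y] by [].
by apply: preimage_closed => [x _|]; [exact: cf|exact: closed_ge].
Qed.

Lemma closed_le_preimage {R : realType} {X : topologicalType} (f : X -> R) r :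
  continuous f -> closed [set x | f x <= r].
Proof.
move=> cf; have -> : [set x | f x <= r] = f @^-1` [set y | y <= r] by [].
by apply: preimage_closed => [x _|]; [exact: cf|exact: closed_le].
Qed.

(** * Affine forms on the orthant *)

Section Affine.
Context {R : realType} {n : nat}.
Implicit Types (c x z : 'cV[R]_n) (u v : 'I_n.+1 -> R).

Lemma dot_continuous c : continuous (dot c).
Proof.
apply: (continuous_big (@add_continuous R)) => i _ x.
by apply: continuousM; [exact: cst_continuous|exact: coord_continuous].
Qed.

Lemma affine_dot u x :
  affine u x = dot (\col_i u (lift ord0 i)) x + u ord0.
Proof. by congr (_ + _); apply: eq_bigr => i _; rewrite mxE. Qed.

Lemma affine_continuous u : continuous (affine u).
Proof.
rewrite (_ : affine u = fun x => dot (\col_i u (lift ord0 i)) x + u ord0).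
  move=> x; apply: continuousD; last exact: cst_continuous.
  exact: dot_continuous.
by apply/funext => x; exact: affine_dot.
Qed.

Lemma dot_segment c x z t :
  dot c ((1 - t) *: x + t *: z) = (1 - t) * dot c x + t * dot c z.
Proof.
rewrite /dot !mulr_sumr -big_split /=; apply: eq_bigr => i _.
by rewrite !mxE mulrDr !(mulrCA (c i _)).
Qed.

Lemma affine_segment u x z t :
  affine u ((1 - t) *: x + t *: z) = (1 - t) * affine u x + t * affine u z.
Proof. rewrite !affine_dot dot_segment; lra. Qed.

Lemma orthant_segment x z t : 0 <= t <= 1 ->
  orthant x -> orthant z -> orthant ((1 - t) *: x + t *: z).
Proof.
move=> /andP[t0 t1] x0 z0 i; rewrite !mxE.
by rewrite addr_ge0 ?mulr_ge0 ?subr_ge0.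
Qed.

Lemma affine_le u v x : orthant x -> (forall i, u i <= v i) ->
  affine u x <= affine v x.
Proof.
by move=> x0 uv; apply: lerD => //; apply: ler_sum => i _; rewrite ler_wpM2r.
Qed.

(** Sums coefficientwise estimates with error [v i * d], the constant term included, into one
    estimate of the constraint with error constant [affine v x]. *)
Lemma affine_shift u v d x :
  affine (fun i => u i - v i * d) x = affine u x - affine v x * d.
Proof.
rewrite /affine mulrDl opprD mulr_suml addrACA -sumrB; congr (_ + _).
by apply: eq_bigr => i _; rewrite mulrBl mulrAC.
Qed.

Lemma affine_ge0 u x : orthant x -> (forall i, 0 <= u i) -> 0 <= affine u x.
Proof.
by move=> x0 u0; rewrite addr_ge0 ?sumr_ge0// => i _; rewrite mulr_ge0.
Qed.

Lemma orthant_closed : closed (@orthant R n).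
Proof.
rewrite (_ : orthant = \bigcap_i [set x : 'cV[R]_n | 0 <= x i ord0]).
  apply: closed_bigI => i _.
  apply: closed_ge_preimage; exact: coord_continuous.
by apply/seteqP; split=> x h i; [move=> _; exact: h|exact: h].
Qed.

Lemma feasible_closed a b (coef : 'I_n.+1 -> R -> R) :
  closed (feasible a b coef).
Proof.
rewrite (_ : feasible a b coef = orthant `&`
  \bigcap_(y in `[a, b]) [set x | 0 <= affine (coef ^~ y) x]).
  apply: closedI; first exact: orthant_closed.
  apply: closed_bigI => y _.
  apply: closed_ge_preimage; exact: affine_continuous.
by apply/seteqP; split=> x [x0 h]; split.
Qed.

End Affine.

Lemma closed_cluster {X : topologicalType} (F : set_system X) (A : set X) x :
  closed A -> F A -> cluster F x -> A x.
Proof. by move=> cA FA Fx; apply: cA => B; exact: Fx. Qed.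

(** Turns the tightness bound of order [p] into a linear one on intervals of length at most 1. *)
Lemma powR_le_self {R : realType} (d p : R) : 0 <= d <= 1 -> 1 <= p ->
  d `^ p <= d.
Proof.
move=> /andP[]; rewrite le_eqVlt => /predU1P[<- _ p1|d0 d1 p1].
  by rewrite powR0// gt_eqF// (lt_le_trans ltr01).
by rewrite -[leRHS]powRr1 ?(ltW d0)//; apply: ger_powR; rewrite ?d0.
Qed.

(** * Cells of a subdivision *)

Section Subdivision.
Context {R : realType}.
Implicit Types (a b y : R) (T : seq R).

(** Induction on the number of cells: either [y] lies in the last cell, or it lies to the left of it
    and the remaining cells cover it. *)
Lemma subdivision_cover a b T y : subdivision a b T -> y \in `[a, b] ->
  exists2 k, (k < (size T).-1)%N & T`_k <= y <= T`_k.+1.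
Proof.
move=> [T1 <- <- _]; rewrite in_itv/= => /andP[ay].
have: (0 < (size T).-1)%N by case: (size T) T1 => [|[]].
elim: (size T).-1 => // m IH _ yb.
have [ym|my] := leP T`_m y; first by exists m => //; rewrite ym.
(* With a single cell, [my] would put [y] to the left of [a]. *)
case: m => [|m] in IH yb my *; first by rewrite ltNge ay in my.
have [//|k km ky] := IH _ (ltW my).
by exists k => //; exact: ltnW.
Qed.

Lemma subdivision_cell a b T k : subdivision a b T -> (k < (size T).-1)%N ->
  [/\ a <= T`_k, T`_k <= T`_k.+1 & T`_k.+1 <= b].
Proof.
move=> [T1 <- <- sT] kT.
have T0 : (0 < size T)%N by exact: ltnW.
have kS : (k.+1 < size T)%N by rewrite -(prednK T0) ltnS.
have mono := sorted_leq_nth le_trans le_refl 0 sT.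
by split; apply: mono; rewrite ?inE ?prednK// ltnW.
Qed.

Lemma cell_le_mesh T k : (k < (size T).-1)%N -> T`_k.+1 - T`_k <= mesh T.
Proof.
move=> kT; apply: le_trans (ler_norm _) _.
apply: (le_bigmax_seq 0 k xpredT (fun k => `|T`_k.+1 - T`_k|)) => //.
by rewrite mem_index_iota.
Qed.

End Subdivision.

(** * Consequences of the inclusion bounds *)

Section Inclusion.
Context {R : realType} {n : nat} (a b : R).
Context (coef : 'I_n.+1 -> R -> R) (Al Au : 'I_n.+1 -> set R -> R).
Context (hincl : inclusion_functions a b coef Al Au).
Implicit Types (x z : 'cV[R]_n) (T : seq R).

Lemma inclusion_lower i s t y : a <= s -> t <= b -> s <= y <= t ->
  Al i `[s, t]%classic <= coef i y.
Proof.
move=> as_ tb sy; have /andP[sy' yt] := sy.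
have im : (coef i @` `[s, t]) (coef i y) by exists y => //=; rewrite in_itv.
have := @hincl i s t as_ (le_trans sy' yt) tb _ im.
by rewrite /= in_itv /= => /andP[].
Qed.

Lemma approx_feasible_sub T : subdivision a b T ->
  approx_feasible Al T `<=` feasible a b coef.
Proof.
move=> sT x [x0 xT]; split=> // y yab.
have [k kT ky] := subdivision_cover sT yab.
have [ak _ kb] := subdivision_cell sT kT.
apply: le_trans (xT k kT) _; apply: affine_le => // i.
exact: inclusion_lower ky.
Qed.

Context (htight : tight_inclusion a b coef Al Au).

(** The value [coef i y] is at most the upper end [Au], and [Al] is below [Au] by at most the width
    bound, which is linear for length at most 1. *)
Lemma tight_lower : exists2 delta : 'I_n.+1 -> R, forall i, 0 <= delta i &
  forall i s t y, a <= s -> t <= b -> s <= y <= t -> t - s <= 1 ->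
  coef i y - delta i * (t - s) <= Al i `[s, t]%classic.
Proof.
have [p [gamma [delta [p1 _ delta0 tight]]]] := htight.
exists delta => // i s t y as_ tb sy ts1.
have st : s <= t by case/andP: sy; exact: le_trans.
have [_] := tight i s t as_ st tb.
have im : (coef i @` `[s, t]) (coef i y) by exists y => //=; rewrite in_itv.
have := @hincl i s t as_ st tb _ im; rewrite /= in_itv /= => /andP[_ yu].
rewrite distrC => /(le_trans (ler_norm _)) ul.
have pd : delta i * (t - s) `^ p <= delta i * (t - s).
  by rewrite ler_wpM2l// powR_le_self// subr_ge0 st.
by rewrite lerBlDr -lerBlDl (le_trans _ (le_trans ul pd))// lerB.
Qed.

(** On the interval with endpoints [s] and [t], the lower end [Al] lies below the value at [s] and,
    by tightness, not far below the value at [t]. The one-sided form suffices, since [s] and [t] can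
    be exchanged. *)
Lemma coef_lipschitz : exists2 delta : 'I_n.+1 -> R, forall i, 0 <= delta i &
  forall i s t, s \in `[a, b] -> t \in `[a, b] -> `|t - s| <= 1 ->
  coef i t - delta i * `|t - s| <= coef i s.
Proof.
have [delta delta0 lo] := tight_lower; exists delta => // i s t.
rewrite !in_itv/= => /andP[as_ sb] /andP[at_ tb].
have [st|/ltW ts] := leP s t.
  rewrite ger0_norm ?subr_ge0// => ts1.
  apply: le_trans (lo i s t t _ _ _ _) _ => //; first by rewrite st lexx.
  by apply: inclusion_lower; rewrite ?lexx.
rewrite ler0_norm ?subr_le0// opprB => ts1.
apply: le_trans (lo i t s t _ _ _ _) _ => //; first by rewrite lexx.
by apply: inclusion_lower; rewrite ?lexx ?andbT.
Qed.

Lemma constraint_continuous x : orthant x ->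
  {within `[a, b], continuous (fun y => affine (coef ^~ y) x)}.
Proof.
move=> x0; have [delta delta0 lip] := coef_lipschitz.
have D0 := affine_ge0 x0 delta0; set D := affine delta x in D0.
have lipx s t : s \in `[a, b] -> t \in `[a, b] -> `|t - s| <= 1 ->
    affine (coef ^~ t) x - affine (coef ^~ s) x <= D * `|t - s|.
  move=> sab tab ts1; rewrite lerBlDr -lerBlDl -affine_shift.
  by apply: affine_le => // i; exact: lip.
apply/subspace_continuousP => s /= sab; apply/cvgrPdist_le => e e0.
(* Dividing by [D + 1] avoids the case [D = 0]. *)
have D1 : 0 < D + 1 by rewrite ltr_wpDl.
near=> t.
have tab : t \in `[a, b] by near: t; exact: withinT.
have st : `|s - t| <= Num.min 1 (e / (D + 1)).
  near: t; apply: (@cvgr_dist_le _ _ _ (within `[a, b] (nbhs s)) _ id s).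
    exact: cvg_within.
  by rewrite lt_min ltr01 divr_gt0.
move: st; rewrite le_min => /andP[st1].
rewrite ler_pdivlMr// => ste.
have De : D * `|s - t| <= e by have := normr_ge0 (s - t); lra.
(* Each side of the absolute value is [lipx], once with the two points exchanged. *)
rewrite ler_norml lerNl opprB; apply/andP; split.
  by apply: le_trans De; rewrite (distrC s); apply: lipx => //; rewrite distrC.
by apply: le_trans De; exact: lipx.
Unshelve. all: by end_near. Qed.

(** The margin is the minimum of a continuous function on a compact interval, attained at a point
    where it is positive. *)
Lemma slater_margin x : a <= b -> slater_point a b coef x ->
  exists2 e, 0 < e & forall y, y \in `[a, b] -> e <= affine (coef ^~ y) x.
Proof.
move=> ab [x0 xpos].
have [y yab ymin] := EVT_min ab (constraint_continuous x0).
by exists (affine (coef ^~ y) x); [exact: xpos|].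
Qed.

Lemma slater_near_approx_feasible x (T : nat -> seq R) : a <= b ->
  slater_point a b coef x ->
  (forall k, subdivision a b (T k)) -> mesh (T k) @[k --> \oo] --> (0 : R) ->
  \forall k \near \oo, approx_feasible Al (T k) x.
Proof.
move=> ab xS sT mT; have [x0 _] := xS.
have [e e0 ex] := slater_margin ab xS.
have [delta delta0 lo] := tight_lower.
have D0 := affine_ge0 x0 delta0; set D := affine delta x in D0.
have D1 : 0 < D + 1 by rewrite ltr_wpDl.
(* The bound 1 makes [tight_lower] applicable on every cell; the other keeps the loss [D * d] within
   the margin [e]. *)
have : \forall k \near \oo, `|0 - mesh (T k)| <= Num.min 1 (e / (D + 1)).
  by move/cvgrPdist_le: mT; apply; rewrite lt_min ltr01 divr_gt0.
apply: filterS => k; rewrite sub0r normrN => /(le_trans (ler_norm _)).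
rewrite le_min => /andP[m1 me]; split=> // j jT.
have jm := cell_le_mesh jT.
have [aj jj jb] := subdivision_cell (sT k) jT.
set d := (_ - _) in jm.
have d0 : 0 <= d by rewrite subr_ge0.
have De : D * d <= e.
  by have := le_trans jm me; rewrite ler_pdivlMr//; lra.
(* The lower coefficients of a cell are compared with the values at its left breakpoint, where the
   constraint is at least [e]. *)
have := @affine_le _ _ (fun i => coef i (T k)`_j - delta i * d)
  (Al ^~ (cell (T k) j)) x x0.
rewrite affine_shift -/D => /(_ _) H; apply: le_trans (H _).
  rewrite subr_ge0 (le_trans De)// ex// in_itv/= aj.
  exact: le_trans jj jb.
by move=> i; apply: lo => //; rewrite ?lexx ?jj// (le_trans jm).
Qed.

End Inclusion.

(** * Segments towards a Slater point *)

Lemma slater_segment {R : realType} {n : nat} a b coef (x z : 'cV[R]_n) t :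
  0 < t <= 1 -> feasible a b coef x -> slater_point a b coef z ->
  slater_point a b coef ((1 - t) *: x + t *: z).
Proof.
move=> /andP[t0 t1] [x0 xF] [z0 zS]; split.
  by apply: orthant_segment; rewrite ?(ltW t0).
move=> y yab; rewrite affine_segment.
(* The weight [t] of the Slater point is positive, so its strict inequality survives. *)
by rewrite ltr_wpDl ?mulr_ge0 ?subr_ge0 ?mulr_gt0// ?xF ?zS.
Qed.

Lemma le_segment_lim {R : realFieldType} (u v w : R) :
  (forall t, 0 < t <= 1 -> u <= (1 - t) * v + t * w) -> u <= v.
Proof.
move=> h; have [//|vu] := leP u v.
have wu : u <= w by have := h 1; rewrite ltr01 lexx => /(_ isT); lra.
have wv0 : 0 < w - v by lra.
(* At this [t] the segment value is the midpoint of [v] and [u], which is below [u]; [u <= w] gives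
   [t <= 1]. *)
have := h ((u - v) / (2 * (w - v))).
have -> : 0 < (u - v) / (2 * (w - v)) <= 1.
  apply/andP; split; first by rewrite divr_gt0//; lra.
  by rewrite ler_pdivrMr; lra.
move=> /(_ isT); set t := (_ / _).
have : t * (2 * (w - v)) = u - v by rewrite /t divfK//; apply: lt0r_neq0; lra.
lra.
Qed.

(** * Passage to the limit *)

Unset Implicit Arguments.
Set Strict Implicit.

Theorem theorem3p4 (R : realType) (n : nat) (a b : R) (hab : a < b)
  (c : 'cV[R]_n) (coef : 'I_n.+1 -> R -> R)
  (Al Au : 'I_n.+1 -> set R -> R)
  (hincl : inclusion_functions a b coef Al Au)
  (htight : tight_inclusion a b coef Al Au)
  (hslater : slater_condition a b coef)
  (hlevel : exists xbar : 'cV[R]_n,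
     slater_point a b coef xbar /\ bounded_set (level_set a b coef c xbar))
  (T : nat -> seq R)
  (hsub : forall k, subdivision a b (T k))
  (hcons : consistent Al (T 0%N))
  (hnested : forall k, {subset T k <= T k.+1})
  (hmesh : mesh (T k) @[k --> \oo] --> (0 : R))
  (xs : nat -> 'cV[R]_n)
  (hopt : forall k, optimal_solution c (approx_feasible Al (T k)) (xs k))
  (x : 'cV[R]_n)
  (hacc : cluster (xs k @[k --> \oo]) x) :
  optimal_solution c (feasible a b coef) x.
Proof.
have [xbar xbarS] := hslater.
split.
  apply: (closed_cluster (@feasible_closed _ _ a b coef)) hacc.
  exists 0%N => // k _ /=; have [xk _] := hopt k.
  exact: (approx_feasible_sub hincl (hsub k)).
move=> z zF; apply: (@le_segment_lim _ _ _ (dot c xbar)) => t t01.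
rewrite -dot_segment; set zt := (_ + _).
have ztS : slater_point a b coef zt by exact: slater_segment.
(* With [t] fixed, this closed half-space contains [xs k] for all large [k]: then [zt] is feasible
   for the approximate problem, and [xs k] is optimal there. *)
have closed_dot : closed [set y : 'cV[R]_n | dot c y <= dot c zt].
  apply: closed_le_preimage; exact: dot_continuous.
apply: (closed_cluster closed_dot) hacc.
have := slater_near_approx_feasible hincl htight (ltW hab) ztS hsub hmesh.
by apply: filterS => k; have [_] := hopt k; exact.
Qed.
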